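(* Let $E$ be a Banach lattice and let $\lambda$ be an invariant sequence lattice. Then $\lambda_\pi(E)\setminus\lambda_s(E)$ is either empty or completely latticeable in $\lambda_\pi(E)$.
   Context: Complete latticeability. A subset $A$ of a Banach lattice $X$ is completely latticeable (in $X$) if there is a closed infinite dimensional sublattice (Riesz subspace) of $X$ all of whose elements but the origin belong to $A$. Scalar sequence spaces. A sequence space is a linear subspace $\lambda$ of $\mathbb{R}^{\mathbb{N}}$; all sequence spaces are considered as Banach lattices with the coordinatewise order. $e_j$ denotes the $j$-th canonical unit vector. The Köthe dual of $\lambda$ is $$\lambda'=\Big\{(b_j)_{j=1}^\infty\in\mathbb{R}^{\mathbb{N}}:\ \sum_{j=1}^\infty|a_jb_j|<\infty\ \text{for every } (a_j)_{j=1}^\infty\in\lambda\Big\}.$$ If $\lambda$ is order continuous (in particular if it is a KB-space, i.e. every increasing norm bounded sequence of positive elements is norm convergent), then $\lambda'$ is identified with the dual $\lambda^*$ and is a Banach lattice with the norm $\|(b_j)_j\|_{\lambda'}=\sup_{(a_j)_j\in B_\lambda}\big|\sum_{j=1}^\infty a_jb_j\big|$, where $B_X$ denotes the closed unit ball of $X$. For a sequence $x=(x_j)_{j=1}^\infty$ in a linear space, $x^0:=(x^0_j)_{j=1}^\infty$, where $x^0_j$ is the $j$-th nonzero coordinate of $x$ if such a coordinate exists and zero otherwise. An invariant sequence lattice is a sequence space $\lambda$ that is a KB-space with $\|e_j\|_\lambda=1$ for every $j\in\mathbb{N}$ and such that: (i) for $x\in\mathbb{R}^{\mathbb{N}}$,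 $x\in\lambda'\Leftrightarrow x^0\in\lambda'$ and, in this case, $\|x\|_{\lambda'}=\|x^0\|_{\lambda'}$; (ii) if $x\in\lambda'$, then every subsequence $z$ of $x$ belongs to $\lambda'$ and $\|z\|_{\lambda'}\le\|x\|_{\lambda'}$. Vector-valued sequence spaces. For a Banach lattice $E$ and a KB-space $\lambda$ with $\|e_j\|_\lambda=1$ for every $j$: $$\lambda'_w(E^* )=\{(x^*_j)_j\in(E^* )^{\mathbb{N}}:(x^*_j(x))_j\in\lambda'\ \text{for every }x\in E\},\quad \|(x^*_j)_j\|_w=\sup_{x\in B_E}\|(x^*_j(x))_j\|_{\lambda'},$$ $$\lambda_s(E)=\Big\{(x_j)_j\in E^{\mathbb{N}}:\sum_{j=1}^\infty|x^*_j(x_j)|<\infty\ \text{for every }(x^*_j)_j\in\lambda'_w(E^* )\Big\},$$ which is a Banach space with the norm $\|(x_j)_j\|_s=\sup_{(x^*_j)_j\in B_{\lambda'_w(E^* )}}\big|\sum_{j}x^*_j(x_j)\big|$; $$\lambda'_\varepsilon(E^* )=\{(x^*_j)_j\in(E^* )^{\mathbb{N}}:(|x^*_j|(x))_j\in\lambda'\ \text{for every }x\in E^+\},\quad \|(x^*_j)_j\|_\varepsilon=\sup_{x\in B_{E^+}}\|(|x^*_j|(x))_j\|_{\lambda'},$$ $$\lambda_\pi(E)=\Big\{(x_j)_j\in E^{\mathbb{N}}:\sum_{j=1}^\infty x^*_j(|x_j|)<\infty\ \text{for every }(x^*_j)_j\in\lambda'_\varepsilon(E^* )^+\Big\},$$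 $$\|(x_j)_j\|_\pi=\sup_{(x^*_j)_j\in B_{\lambda'_\varepsilon(E^* )^+}}\sum_{j=1}^\infty x^*_j(|x_j|).$$ Here $X^+$ is the positive cone and $B_{X^+}=B_X\cap X^+$. The spaces $\lambda'_\varepsilon(E^* )$ and $\lambda_\pi(E)$ are Banach lattices with the coordinatewise order and the norms given, and $\lambda_s(E)$ is a linear subspace of $\lambda_\pi(E)$. *)

(* Defs.v *)
From HB Require Import structures.
From mathcomp Require Import all_boot all_order all_algebra.
From mathcomp Require Import all_classical all_reals all_analysis.

Set Implicit Arguments.
Unset Strict Implicit.
Unset Printing Implicit Defensive.

Import Order.TTheory GRing.Theory Num.Theory.
Import numFieldNormedType.Exports.

Local Open Scope classical_set_scope.
Local Open Scope ring_scope.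

(* MathComp's [Order.Lattice] cannot be joined with [GRing.Lmodule] outside of
   the numeric hierarchy, hence a dedicated order relation [rle], whose binary
   suprema and infima are [rjoin] and [rmeet]. In ring_scope `|x| is always the
   norm; the lattice modulus is [modulus]. *)
HB.mixin Record Lmodule_isRieszSpace (R : realType) V of GRing.Lmodule R V := {
  rle : V -> V -> Prop ;
  rle_refl : forall x, rle x x ;
  rle_anti : forall x y, rle x y -> rle y x -> x = y ;
  rle_trans : forall y x z, rle x y -> rle y z -> rle x z ;
  rle_add2r : forall z x y, rle x y -> rle (x + z) (y + z) ;
  rle_scale : forall (a : R) x y, 0 <= a -> rle x y -> rle (a *: x) (a *: y) ;
  rjoin : V -> V -> V ;
  rle_joinl : forall x y, rle x (rjoin x y) ;
  rle_joinr : forall x y, rle y (rjoin x y) ;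
  rjoin_le : forall x y z, rle x z -> rle y z -> rle (rjoin x y) z ;
  rmeet : V -> V -> V ;
  rle_meetl : forall x y, rle (rmeet x y) x ;
  rle_meetr : forall x y, rle (rmeet x y) y ;
  rle_meet : forall x y z, rle z x -> rle z y -> rle z (rmeet x y)
}.

#[short(type="rieszSpaceType")]
HB.structure Definition RieszSpace (R : realType) :=
  {V of GRing.Lmodule R V & Lmodule_isRieszSpace R V}.

Definition modulus (R : realType) (V : rieszSpaceType R) (x : V) : V :=
  rjoin x (- x).

HB.mixin Record RieszSpace_isBanachLattice (R : realType) V
    of RieszSpace R V & CompleteNormedModule R V := {
  ler_norm_modulus : forall x y : V,
    rle (modulus x) (modulus y) -> `|x| <= `|y|
}.

#[short(type="banachLatticeType")]
HB.structure Definition BanachLattice (R : realType) :=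
  {V of RieszSpace R V & CompleteNormedModule R V
   & RieszSpace_isBanachLattice R V}.

Section FunRiesz.
Variables (T : Type) (R : realType) (V : rieszSpaceType R).
Implicit Types f g h : T -> V.

Definition fun_rle f g : Prop := forall t, rle (f t) (g t).
Definition fun_rjoin f g : T -> V := fun t => rjoin (f t) (g t).
Definition fun_rmeet f g : T -> V := fun t => rmeet (f t) (g t).

Let fun_rle_refl f : fun_rle f f.
Proof. by move=> t; exact: rle_refl. Qed.

Let fun_rle_anti f g : fun_rle f g -> fun_rle g f -> f = g.
Proof. by move=> fg gf; apply/funext => t; exact: rle_anti. Qed.

Let fun_rle_trans g f h : fun_rle f g -> fun_rle g h -> fun_rle f h.
Proof. by move=> fg gh t; exact: rle_trans (fg t) (gh t). Qed.

Let fun_rle_add2r h f g : fun_rle f g -> fun_rle (f + h) (g + h).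
Proof. by move=> fg t; exact: rle_add2r. Qed.

Let fun_rle_scale (a : R) f g :
  0 <= a -> fun_rle f g -> fun_rle (a *: f) (a *: g).
Proof. by move=> a0 fg t; exact: rle_scale. Qed.

Let fun_rle_joinl f g : fun_rle f (fun_rjoin f g).
Proof. by move=> t; exact: rle_joinl. Qed.

Let fun_rle_joinr f g : fun_rle g (fun_rjoin f g).
Proof. by move=> t; exact: rle_joinr. Qed.

Let fun_rjoin_le f g h :
  fun_rle f h -> fun_rle g h -> fun_rle (fun_rjoin f g) h.
Proof. by move=> fh gh t; exact: rjoin_le. Qed.

Let fun_rle_meetl f g : fun_rle (fun_rmeet f g) f.
Proof. by move=> t; exact: rle_meetl. Qed.

Let fun_rle_meetr f g : fun_rle (fun_rmeet f g) g.
Proof. by move=> t; exact: rle_meetr. Qed.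

Let fun_rle_meet f g h :
  fun_rle h f -> fun_rle h g -> fun_rle h (fun_rmeet f g).
Proof. by move=> hf hg t; exact: rle_meet. Qed.

HB.instance Definition _ := Lmodule_isRieszSpace.Build R (T -> V)
  fun_rle_refl fun_rle_anti fun_rle_trans fun_rle_add2r fun_rle_scale
  fun_rle_joinl fun_rle_joinr fun_rjoin_le
  fun_rle_meetl fun_rle_meetr fun_rle_meet.

End FunRiesz.

Definition KB_space (R : realType) (X : banachLatticeType R) : Prop :=
  forall u : nat -> X,
    (forall m n, (m <= n)%N -> rle (u m) (u n)) -> (forall n, rle 0 (u n)) ->
    (exists C : R, forall n, `|u n| <= C) -> cvgn u.

Definition infinite_dimensional (R : realType) (V : lmodType R) (M : set V) :
    Prop :=
  forall n : nat, exists v : 'I_n -> V,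
    (forall i, M (v i)) /\
    (forall c : 'I_n -> R, \sum_i c i *: v i = 0 -> forall i, c i = 0).

(* The Banach lattice X is presented as a subset of a Riesz space V that is
   stable under the linear and lattice operations of V, with a norm [N] of which
   only the values on X matter. *)
Section CompleteLatticeability.
Variables (R : realType) (V : rieszSpaceType R).
Variables (X : set V) (N : V -> \bar R).

Record sublattice (M : set V) : Prop := {
  sublattice_sub : M `<=` X ;
  sublattice0 : M 0 ;
  sublattice_linear : forall (a : R) (x y : V), M x -> M y -> M (a *: x + y) ;
  sublattice_join : forall x y : V, M x -> M y -> M (rjoin x y) ;
  sublattice_meet : forall x y : V, M x -> M y -> M (rmeet x y)
}.

Definition norm_closed (M : set V) : Prop :=
  forall x : V, X x ->
    (forall e : R, 0 < e -> exists2 y, M y & (N (x - y)%R < e%:E)%E) -> M x.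

Definition completely_latticeable (A : set V) : Prop :=
  exists M : set V,
    [/\ sublattice M, norm_closed M, infinite_dimensional M
      & forall x, M x -> x != 0 -> A x].

End CompleteLatticeability.

(* A sequence space that is a Banach lattice for the coordinatewise order: the
   abstract Banach lattice L is identified with the subspace [range coord] of
   R^nat; injectivity of [coord] follows from [le_coord]. Coordinates are
   numbered from 0. *)
HB.mixin Record BanachLattice_isSequenceSpace (R : realType) L
    of BanachLattice R L := {
  coord : L -> nat -> R ;
  coord_linear : forall j, scalar (fun a => coord a j) ;
  le_coord : forall a b : L, rle a b <-> forall j, coord a j <= coord b j
}.

#[short(type="sequenceSpaceType")]
HB.structure Definition SequenceSpace (R : realType) :=
  {L of BanachLattice R L & BanachLattice_isSequenceSpace R L}.

Lemma coord_inj (R : realType) (L : sequenceSpaceType R) :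
  injective (coord : L -> nat -> R).
Proof. by move=> a b ab; apply/rle_anti; apply/le_coord => j; rewrite ab. Qed.

Section KotheDual.
Variables (R : realType) (L : sequenceSpaceType R).

Definition kothe_dual : set (nat -> R) :=
  [set b | forall a : L, cvgn [normed series (fun j => coord a j * b j)]].

Definition kothe_norm (b : nat -> R) : \bar R :=
  ereal_sup [set (`| limn (series (fun j => coord a j * b j)) |)%:E
            | a in [set a : L | `|a| <= 1]].

End KotheDual.

(* The sequence x^0: the n such that [x n] is the nonzero coordinate of x of
   rank j is unique if it exists, in which case [xget] picks [x n]. *)
Definition nonzero_coords (V : zmodType) (x : nat -> V) (j : nat) : V :=
  xget 0 [set x n | n in
    [set n | x n != 0 /\ (\sum_(0 <= i < n) (x i != 0%R))%N = j]].

Record invariant_sequence_lattice (R : realType) (L : sequenceSpaceType R)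
    : Prop := {
  inv_KB : KB_space L ;
  inv_unit : forall j : nat,
    exists2 e : L, coord e = (fun i => (i == j)%:R) & `|e| = 1 ;
  inv_nonzero : forall x : nat -> R,
    kothe_dual L x <-> kothe_dual L (nonzero_coords x) ;
  inv_nonzero_norm : forall x : nat -> R,
    kothe_dual L x -> kothe_norm L x = kothe_norm L (nonzero_coords x) ;
  inv_subseq : forall (x : nat -> R) (phi : nat -> nat),
    kothe_dual L x -> increasing_seq phi -> kothe_dual L (x \o phi) ;
  inv_subseq_norm : forall (x : nat -> R) (phi : nat -> nat),
    kothe_dual L x -> increasing_seq phi ->
    (kothe_norm L (x \o phi) <= kothe_norm L x)%E
}.

Section Dual.
Variables (R : realType) (E : banachLatticeType R).

Definition dual : set (E -> R) := [set f : E -> R | scalar f /\ continuous f].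

Definition dual_le (f g : E -> R) : Prop :=
  forall x : E, rle 0 x -> f x <= g x.

(* The modulus in the dual: the least upper bound of f and - f for [dual_le]
   among the elements of the dual. *)
Definition dual_modulus (f : E -> R) : E -> R :=
  xget (cst 0) [set g | [/\ dual g, dual_le f g, dual_le (\- f) g
    & forall h, dual h -> dual_le f h -> dual_le (\- f) h -> dual_le g h]].

End Dual.

Section VectorValuedSequences.
Variables (R : realType) (L : sequenceSpaceType R) (E : banachLatticeType R).

Definition lambda'_w : set (nat -> E -> R) :=
  [set f | (forall j, dual (f j)) /\
           forall x : E, kothe_dual L (fun j => f j x)].

Definition lambda_s : set (nat -> E) :=
  [set x | forall f, lambda'_w f -> cvgn [normed series (fun j => f j (x j))]].

Definition lambda'_eps : set (nat -> E -> R) :=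
  [set f | (forall j, dual (f j)) /\
           forall x : E, rle 0 x ->
             kothe_dual L (fun j => dual_modulus (f j) x)].

Definition norm_eps (f : nat -> E -> R) : \bar R :=
  ereal_sup [set kothe_norm L (fun j => dual_modulus (f j) x)
            | x in [set x : E | rle 0 x /\ `|x| <= 1]].

Definition lambda'_eps_pos : set (nat -> E -> R) :=
  [set f | lambda'_eps f /\ forall j, dual_le (cst 0) (f j)].

Definition lambda_pi : set (nat -> E) :=
  [set x | forall f, lambda'_eps_pos f ->
             cvgn (series (fun j => f j (modulus (x j))))].

Definition norm_pi (x : nat -> E) : \bar R :=
  ereal_sup [set (limn (series (fun j => f j (modulus (x j)))))%:E
            | f in [set f | lambda'_eps_pos f /\ (norm_eps f <= 1)%E]].

End VectorValuedSequences.

Arguments lambda'_w {R} L E _.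
Arguments lambda_s {R} L E _.
Arguments lambda'_eps {R} L E _.
Arguments norm_eps {R} L E _.
Arguments lambda'_eps_pos {R} L E _.
Arguments lambda_pi {R} L E _.
Arguments norm_pi {R} L E _.

(* Main.v *)
(* If x lies in lambda_pi(E) but not in lambda_s(E), so does one of x^+ and x^-,
   hence x may be assumed positive. Split N into infinitely many infinite sets
   N_k and let M be the set of all z in lambda_pi(E) whose restriction to N_k,
   read in increasing order, is a multiple a_k x of x, for every k. Since x is
   positive, M is a sublattice, and condition (ii) puts the copies of x carried
   by the N_k into M. If a_k is nonzero and f in lambda'_w of the dual of E
   witnesses that x is not in lambda_s(E), then f spread over N_k is, by
   condition (i), such a witness for z. M is closed because the pi-norm dominates
   the norm of each coordinate; this uses positive functionals norming positive
   vectors, which come from the Hahn-Banach theorem for the sublinear functional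
   that maps u to the norm of u^+. *)
Require Import Defs.
From mathcomp Require Import all_boot all_order all_algebra.
From mathcomp Require Import all_classical all_reals all_analysis.

Set Implicit Arguments.
Unset Strict Implicit.
Unset Printing Implicit Defensive.

Import Order.TTheory GRing.Theory Num.Theory.
Import numFieldNormedType.Exports.

Local Open Scope classical_set_scope.
Local Open Scope ring_scope.

Arguments rle_trans {R s y x z}.
Arguments rle_add2r {R s} z {x y}.
Arguments rle_scale {R s a x y}.
Arguments ler_norm_modulus {R s x y}.

(** * Riesz space calculus: multiples of a positive vector, modulus, positive part *)

Section RieszSpace.
Variables (R : realType) (V : rieszSpaceType R).
Implicit Types (x y z : V) (a b : R).

Lemma rsubr_ge0 x y : rle 0 (y - x) <-> rle x y.
Proof.
split=> [/(rle_add2r x)|/(rle_add2r (- x))]; first by rewrite add0r subrK.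
by rewrite subrr.
Qed.

Lemma rle_add x y x' y' : rle x y -> rle x' y' -> rle (x + x') (y + y').
Proof.
move=> xy xy'; apply: rle_trans (rle_add2r _ xy) _.
by rewrite ![y + _]addrC; exact: rle_add2r.
Qed.

Lemma rscale_ge0 a x : 0 <= a -> rle 0 x -> rle 0 (a *: x).
Proof. by move=> a0 /(rle_scale a0); rewrite scaler0. Qed.

Lemma rle_scaler a b x : rle 0 x -> a <= b -> rle (a *: x) (b *: x).
Proof.
move=> x0 ab; apply/rsubr_ge0; rewrite -scalerBl.
by apply: rscale_ge0; rewrite ?subr_ge0.
Qed.

(** Multiples of a positive vector are totally ordered, so their join is the larger one. With
    [rmeet_scale], this makes sequences of multiples of a positive sequence stable under the lattice
    operations. *)
Lemma rjoin_scale a b x : rle 0 x ->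
  rjoin (a *: x) (b *: x) = Num.max a b *: x.
Proof.
move=> x0; apply: rle_anti.
  by apply: rjoin_le; apply: rle_scaler; rewrite // le_max lexx ?orbT.
by case: leP => _; [exact: rle_joinr | exact: rle_joinl].
Qed.

Lemma rmeet_scale a b x : rle 0 x ->
  rmeet (a *: x) (b *: x) = Num.min a b *: x.
Proof.
move=> x0; apply: rle_anti; last first.
  by apply: rle_meet; apply: rle_scaler; rewrite // ge_min lexx ?orbT.
by case: leP => _; [exact: rle_meetl | exact: rle_meetr].
Qed.

Lemma modulus_scale a x : rle 0 x -> modulus (a *: x) = `|a| *: x.
Proof.
by move=> x0; rewrite /modulus -scaleNr rjoin_scale// maxrN.
Qed.

Lemma modulus_id x : rle 0 x -> modulus x = x.
Proof.
by move=> x0; rewrite -[in LHS](scale1r x) modulus_scale// normr1 scale1r.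
Qed.

Lemma rle_modulus x : rle x (modulus x).
Proof. exact: rle_joinl. Qed.

Lemma rle_modulusN x : rle (- x) (modulus x).
Proof. exact: rle_joinr. Qed.

Lemma modulus_ge0 x : rle 0 (modulus x).
Proof.
(* Adding x <= |x| and -x <= |x| gives 0 <= 2|x|, which is then halved. *)
have := rle_add (rle_modulus x) (rle_modulusN x); rewrite subrr => m0.
have := @rscale_ge0 2^-1 _ _ m0; rewrite invr_ge0 ler0n => /(_ isT).
by rewrite -mulr2n -[modulus x *+ 2]scaler_nat scalerA mulVf ?pnatr_eq0//
  scale1r.
Qed.

Definition pos_part x : V := rjoin x 0.

Lemma pos_part_ge0 x : rle 0 (pos_part x).
Proof. exact: rle_joinr. Qed.

Lemma rle_pos_part x : rle x (pos_part x).
Proof. exact: rle_joinl. Qed.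

Lemma pos_part_id x : rle 0 x -> pos_part x = x.
Proof.
move=> x0; apply: rle_anti; last exact: rle_pos_part.
by apply: rjoin_le => //; exact: rle_refl.
Qed.

Lemma pos_part_le0 x : rle x 0 -> pos_part x = 0.
Proof.
move=> x0; apply: rle_anti; last exact: pos_part_ge0.
by apply: rjoin_le => //; exact: rle_refl.
Qed.

Lemma pos_part_le_modulus x : rle (pos_part x) (modulus x).
Proof. by apply: rjoin_le; [exact: rle_modulus | exact: modulus_ge0]. Qed.

Lemma pos_partN_le_modulus x : rle (pos_part (- x)) (modulus x).
Proof. by apply: rjoin_le; [exact: rle_modulusN | exact: modulus_ge0]. Qed.

Lemma pos_partD x y : rle (pos_part (x + y)) (pos_part x + pos_part y).
Proof.
apply: rjoin_le; first by apply: rle_add; exact: rle_pos_part.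
by rewrite -(addr0 0); apply: rle_add; exact: pos_part_ge0.
Qed.

Lemma pos_partZ a x : 0 <= a -> rle (pos_part (a *: x)) (a *: pos_part x).
Proof.
move=> a0; apply: rjoin_le.
  by apply: rle_scale => //; exact: rle_pos_part.
by apply: rscale_ge0 => //; exact: pos_part_ge0.
Qed.

Lemma pos_partB x : pos_part x - pos_part (- x) = x.
Proof.
suff -> : pos_part x = x + pos_part (- x) by rewrite addrK.
apply: rle_anti.
  apply: rjoin_le.
    rewrite -[X in rle X _]addr0 ![x + _]addrC.
    by apply: rle_add2r; exact: pos_part_ge0.
  by rewrite -(subrr x) ![x + _]addrC; apply: rle_add2r; exact: rle_pos_part.
have : rle (pos_part (- x)) (pos_part x - x).
  apply: rjoin_le; last exact/rsubr_ge0/rle_pos_part.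
  by rewrite -[X in rle X _]add0r; apply: rle_add2r; exact: pos_part_ge0.
by move=> /(rle_add2r x); rewrite subrK addrC.
Qed.

End RieszSpace.

Lemma norm_modulus (R : realType) (E : banachLatticeType R) (x : E) :
  `|modulus x| = `|x|.
Proof.
by apply/le_anti/andP; split; apply: ler_norm_modulus;
  rewrite (modulus_id (modulus_ge0 _)); exact: rle_refl.
Qed.

Lemma ler_norm_pos (R : realType) (E : banachLatticeType R) (x y : E) :
  rle 0 x -> rle x y -> `|x| <= `|y|.
Proof.
move=> x0 xy; apply: ler_norm_modulus.
by rewrite !modulus_id//; exact: rle_trans xy.
Qed.

Section Scalar.
Variables (R : realType) (V : lmodType R) (f : V -> R).
Hypothesis fL : scalar f.

Lemma scalarf0 : f 0 = 0.
Proof. by have := fL (-1) 0 0; rewrite scaler0 addr0 mulN1r addNr. Qed.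

Lemma scalarfD x y : f (x + y) = f x + f y.
Proof. by have := fL 1 x y; rewrite scale1r mul1r. Qed.

Lemma scalarfZ a x : f (a *: x) = a * f x.
Proof. by have := fL a x 0; rewrite scalarf0 !addr0. Qed.

Lemma scalarfN x : f (- x) = - f x.
Proof. by rewrite -scaleN1r scalarfZ mulN1r. Qed.

Lemma scalarfB x y : f (x - y) = f x - f y.
Proof. by rewrite scalarfD scalarfN. Qed.

End Scalar.

(** * The Hahn-Banach theorem by minimal sublinear functionals *)

Section Sublinear.
Variables (R : realType) (V : lmodType R).
Implicit Types (p q : V -> R) (A : set (V -> R)).

Definition sublinear p :=
  (forall x y, p (x + y) <= p x + p y) /\
  (forall (t : R) x, 0 <= t -> p (t *: x) <= t * p x).

Lemma sublinear0 p : sublinear p -> p 0 = 0.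
Proof.
move=> [pD pZ]; apply/le_anti/andP; split.
  by rewrite -[X in p X](scale0r 0) (le_trans (pZ _ _ _))// mul0r.
by have := pD 0 0; rewrite addr0 lerDl.
Qed.

Lemma sublinear_ge p x : sublinear p -> - p (- x) <= p x.
Proof.
move=> pS; rewrite lerNl -subr_ge0 opprK addrC.
by rewrite -(sublinear0 pS) -(subrr x); exact: pS.1.
Qed.

Lemma sublinearZ p (t : R) x : sublinear p -> 0 <= t -> p (t *: x) = t * p x.
Proof.
move=> pS; rewrite le_eqVlt => /predU1P[<-|t0].
  by rewrite scale0r mul0r sublinear0.
apply/le_anti/andP; split; first exact/pS.2/ltW.
rewrite -ler_pdivlMl// -[X in p X <= _](scalerK (lt0r_neq0 t0)).
by apply: pS.2; rewrite invr_ge0 ltW.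
Qed.

(** The function [l] serves only to bound the values at x from below, without which the real [inf]
    would be a default value. *)
Lemma sublinear_inf_le A (l : V -> R) f x :
  (forall g, A g -> l x <= g x) -> A f -> inf [set g x | g in A] <= f x.
Proof.
move=> lA Af; apply: ge_inf; last by exists f.
by exists (l x) => _ [g Ag <-]; exact: lA.
Qed.

(** Common to the two infima needed below: over the shifts of one functional and over a chain. The
    members of A need not be sublinear, and the witness [h] may depend on the points. *)
Lemma sublinear_inf A (l : V -> R) : A !=set0 ->
  (forall f x, A f -> l x <= f x) ->
  (forall f g x y, A f -> A g -> exists2 h, A h & h (x + y) <= f x + g y) ->
  (forall f (t : R) x, A f -> 0 <= t ->
    exists2 h, A h & h (t *: x) <= t * f x) ->
  sublinear (fun x => inf [set f x | f in A]).
Proof.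
move=> [f0 Af0] lA AD AZ.
have ilb f x : A f -> inf [set f x | f in A] <= f x.
  by apply: (sublinear_inf_le (l := l)) => g; exact: lA.
have igt c x : (forall f, A f -> c <= f x) -> c <= inf [set f x | f in A].
  move=> cf; apply: lb_le_inf; first by exists (f0 x), f0.
  by move=> _ [g Ag <-]; exact: cf.
split=> [x y|t x t0].
  rewrite -lerBlDr; apply/igt => f Af; rewrite lerBlDr -lerBlDl.
  apply/igt => g Ag; rewrite lerBlDl.
  by have [h Ah] := AD _ _ x y Af Ag; apply: le_trans; exact: ilb.
have tle f : A f -> inf [set g (t *: x) | g in A] <= t * f x.
  by move=> Af; have [h Ah] := AZ _ _ x Af t0; apply: le_trans; exact: ilb.
(* One cannot divide by t = 0; there [tle] already bounds the infimum by 0. *)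
move: t0; rewrite le_eqVlt => /predU1P[t0|t0].
  by have := tle _ Af0; rewrite -t0 !mul0r.
rewrite mulrC -ler_pdivrMr//; apply/igt => f Af.
by rewrite ler_pdivrMr// mulrC tle.
Qed.

(** Take r(x) to be the infimum over t >= 0 of q(x + ty) - t q(y). The value t = 0 gives r <= q, and
    t = 1 at the point -y gives r(-y) <= -q(y). *)
Lemma sublinear_shift q y : sublinear q ->
  exists2 r, sublinear r & (forall x, r x <= q x) /\ r (- y) <= - q y.
Proof.
move=> qS; have [qD qZ] := qS.
pose s t x := q (x + t *: y) - t * q y.
pose A := [set s t | t in [set t | 0 <= t]].
(* From t q(y) = q((x + ty) - x) <= q(x + ty) + q(-x). *)
have lA f x : A f -> - q (- x) <= f x.
  move=> [t t0 <-]; rewrite /s lerBrDl lerBlDr -sublinearZ//.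
  have {1}-> : t *: y = (x + t *: y) + (- x) by rewrite addrAC subrr add0r.
  exact: qD.
have sA t : 0 <= t -> A (s t) by move=> t0; exists t.
exists (fun x => inf [set f x | f in A]).
  (* The parameters t and u combine to t + u for a sum of points, and u becomes tu for the multiple
     by t. *)
  apply: (sublinear_inf _ lA); first by exists (s 0); exact: sA.
    move=> _ _ x z [t t0 <-] [u u0 <-]; exists (s (t + u)).
      exact/sA/addr_ge0.
    rewrite /s addrACA -opprD -mulrDl scalerDl addrACA lerD2r; exact: qD.
  move=> _ t x [u u0 <-] t0; exists (s (t * u)); first exact/sA/mulr_ge0.
  by rewrite /s mulrBr mulrA lerD2r -scalerA -scalerDr; exact: qZ.
have sle t x : 0 <= t -> inf [set f x | f in A] <= s t x.
  move=> /sA; apply: (sublinear_inf_le (l := fun x => - q (- x))) => g.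
  exact: lA.
split=> [x|]; first apply: le_trans (sle _ x (lexx 0)) _.
  by rewrite /s scale0r mul0r subr0 addr0.
apply: le_trans (sle _ (- y) ler01) _.
by rewrite /s scale1r mul1r addNr sublinear0// sub0r.
Qed.

(* A sublinear functional that is minimal for the pointwise order is linear:
   shifting it in the direction y shows that q (- y) = - q y. *)
Lemma minimal_sublinear_scalar q : sublinear q ->
  (forall r, sublinear r -> (forall x, r x <= q x) -> r = q) -> scalar q.
Proof.
move=> qS qmin.
have qN y : q (- y) = - q y.
  apply/le_anti/andP; split; last by rewrite lerNl; exact: sublinear_ge.
  by have [r rS [rq]] := sublinear_shift y qS; rewrite (qmin r rS rq).
have qD x y : q (x + y) = q x + q y.
  apply/le_anti/andP; split; first exact: qS.1.
  by rewrite -lerN2 opprD -!qN opprD; exact: qS.1.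
move=> a x y; rewrite qD; congr (_ + _).
have [a0|a0] := leP 0 a; first exact: (sublinearZ x qS a0).
by rewrite -[a]opprK scaleNr qN sublinearZ ?oppr_ge0 ?(ltW a0)//= !mulNr.
Qed.

(** Zorn's lemma for the reversed pointwise order, so that a maximal element is a minimal sublinear
    functional. A nonempty chain is bounded by its pointwise infimum, finite because every sublinear
    r <= p satisfies r(x) >= -p(-x). *)
Lemma linear_below_sublinear p : sublinear p ->
  exists2 f : V -> R, scalar f & forall x, f x <= p x.
Proof.
move=> pS.
pose T := {r : V -> R | sublinear r /\ forall x, r x <= p x}.
pose mk r (rS : sublinear r) (rp : forall x, r x <= p x) : T :=
  exist _ r (conj rS rp).
pose ord (r s : T) := `[< forall x, sval s x <= sval r x >].
have [ | | | | [q [qS qp]] qmax] := @Zorn T ord.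
- by move=> r; apply/asboolP.
- move=> r s t /asboolP rs /asboolP st; apply/asboolP => x.
  exact: le_trans (st x) (rs x).
- move=> [r rP] [s sP] /asboolP/= rs /asboolP/= sr; apply: eq_exist => /=.
  by apply/funext => x; apply/le_anti; rewrite rs sr.
- move=> B totB; have [B0|/set0P[r0 Br0]] := eqVneq B set0.
    by exists (mk _ pS (fun=> lexx _)) => s; rewrite B0.
  pose A := [set sval r | r in B].
  have lA f x : A f -> - p (- x) <= f x.
    move=> [[r [rS rp]] _ <-] /=; apply: le_trans (sublinear_ge x rS).
    by rewrite lerN2.
  have iA r x : B r -> inf [set g x | g in A] <= sval r x.
    move=> Br; apply: (sublinear_inf_le (l := fun x => - p (- x))).
      by move=> g; exact: lA.
    by exists r.
  have iS : sublinear (fun x => inf [set f x | f in A]).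
    apply: (sublinear_inf _ lA); first by exists (sval r0), r0.
      move=> _ _ x y [r Br <-] [s Bs <-].
      (* Of two comparable functionals the smaller one serves at both points. *)
      have [/asboolP rs|/asboolP sr] := totB _ _ Br Bs.
        exists (sval s); first by exists s.
        by apply: le_trans ((svalP s).1.1 x y) _; rewrite lerD2r.
      exists (sval r); first by exists r.
      by apply: le_trans ((svalP r).1.1 x y) _; rewrite lerD2l.
    move=> _ t x [r Br <-] t0; exists (sval r); first by exists r.
    exact: (svalP r).1.2.
  have ip x : inf [set f x | f in A] <= p x.
    exact: le_trans (iA _ _ Br0) ((svalP r0).2 x).
  by exists (mk _ iS ip) => s Bs; apply/asboolP => x; exact: iA.
exists q => //; apply: minimal_sublinear_scalar => // r rS rq.
have rp x : r x <= p x := le_trans (rq x) (qp x).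
by have [] : mk _ rS rp = mk _ qS qp by apply: qmax; exact/asboolP.
Qed.

(* The value at v is prescribed by first shifting p in the direction v. *)
Lemma hahn_banach p v : sublinear p ->
  exists2 f : V -> R, scalar f & (forall x, f x <= p x) /\ f v = p v.
Proof.
move=> pS; have [r rS [rp rv]] := sublinear_shift v pS.
have [f fL fr] := linear_below_sublinear rS.
exists f => //; split=> [x|]; first exact: le_trans (fr x) (rp x).
apply/le_anti/andP; split; first exact: le_trans (fr v) (rp v).
by rewrite -lerN2 -(scalarfN fL); exact: le_trans (fr _) rv.
Qed.

End Sublinear.

(** Apply Hahn-Banach to p(u) = ||u^+|| at v. For x >= 0, f(-x) <= ||(-x)^+|| = 0 gives positivity;
    u^+ <= |u| gives the norm bound. *)
Lemma positive_norming_functional (R : realType) (E : banachLatticeType R)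
    (v : E) :
  rle 0 v -> exists f : E -> R,
    [/\ scalar f, dual_le (cst 0) f, forall x, `|f x| <= `|x| & f v = `|v|].
Proof.
move=> v0.
have pS : sublinear (fun x : E => `|pos_part x|).
  split=> [x y|t x t0].
    apply: le_trans (ler_normD _ _); apply: ler_norm_pos (pos_partD x y).
    exact: pos_part_ge0.
  apply: le_trans (ler_norm_pos (pos_part_ge0 _) (pos_partZ x t0)) _.
  by rewrite normrZ ger0_norm.
have [f fL [fp fv]] := hahn_banach v pS.
have fle x : f x <= `|x|.
  rewrite -(norm_modulus x); apply: le_trans (fp x) _.
  exact: ler_norm_pos (pos_part_ge0 _) (pos_part_le_modulus x).
exists f; split=> //.
- move=> x x0; rewrite -lerN2 -(scalarfN fL) oppr0; apply: le_trans (fp _) _.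
  rewrite pos_part_le0 ?normr0//; apply/rsubr_ge0.
  by rewrite opprK add0r.
- by move=> x; rewrite ler_norml fle andbT lerNl -(scalarfN fL) -normrN fle.
- by rewrite fv pos_part_id.
Qed.

(** * A partition of N into infinitely many infinite sets, and sequences spread over them *)

(* [dyadic k] enumerates the set N_k; the predecessor makes the coding onto N,
   with inverse n |-> (dyadic_exp n, dyadic_idx n). *)
Definition dyadic (k j : nat) : nat := (2 ^ k * j.*2.+1).-1.
Definition dyadic_exp (n : nat) : nat := logn 2 n.+1.
Definition dyadic_idx (n : nat) : nat := (n.+1 %/ 2 ^ dyadic_exp n)./2.

Lemma dyadicS k j : (dyadic k j).+1 = (2 ^ k * j.*2.+1)%N.
Proof. by rewrite prednK// muln_gt0 expn_gt0. Qed.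

Lemma dyadic_exp_dyadic k j : dyadic_exp (dyadic k j) = k.
Proof.
rewrite /dyadic_exp dyadicS lognM ?expn_gt0// pfactorK// lognE dvdn2 /=
  odd_double.
by rewrite addn0.
Qed.

Lemma dyadic_idx_dyadic k j : dyadic_idx (dyadic k j) = j.
Proof.
by rewrite /dyadic_idx dyadic_exp_dyadic dyadicS mulKn ?expn_gt0//=
  uphalf_double.
Qed.

(** n + 1 is a power of 2 times an odd number, so the sets N_k cover N. *)
Lemma dyadicK n : dyadic (dyadic_exp n) (dyadic_idx n) = n.
Proof.
apply: succn_inj; rewrite dyadicS /dyadic_idx.
have [m] := pfactor_coprime (isT : prime 2) (ltn0Sn n).
rewrite -/(dyadic_exp n) coprime2n => mo en.
rewrite [in LHS]en mulnK ?expn_gt0// [in RHS]en mulnC.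
by congr (_ * _)%N; rewrite -[RHS]odd_double_half mo.
Qed.

Lemma increasing_dyadic k : increasing_seq (dyadic k).
Proof.
by move=> i j; rewrite -[LHS]ltnS !dyadicS leq_pmul2l ?expn_gt0// ltnS
  leq_double.
Qed.

Lemma leq_dyadic k j : (j <= dyadic k j)%N.
Proof.
rewrite -ltnS dyadicS; apply: (@leq_trans j.*2.+1);
  first by rewrite ltnS -addnn leq_addr.
by rewrite leq_pmull// expn_gt0.
Qed.

(** Indices outside N_k contribute the neutral element, and [dyadic k] enumerates N_k in order. An
    arbitrary monoid law covers both real partial sums and counts of nonzero entries. *)
Lemma big_dyadic (T : Type) (idx : T) (op : Monoid.law idx) (v : nat -> T) k n :
  (forall i, dyadic_exp i != k -> v i = idx) ->
  \big[op/idx]_(0 <= i < dyadic k n) v i =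
  \big[op/idx]_(0 <= j < n) v (dyadic k j).
Proof.
(* An element of N_k below [dyadic k m] has rank less than m; any other index there carries
   [idx]. *)
move=> v0; have dyadicP m i :
    (dyadic_exp i = k -> (dyadic_idx i < m)%N = false) ->
    (i < dyadic k m)%N -> v i = idx.
  move=> im ilt; apply/v0/eqP => ik; have := im ik.
  have := increasing_dyadic k m (dyadic_idx i); rewrite -{2}ik dyadicK.
  by rewrite !leEnat (leqNgt _ i) ilt leqNgt => /esym/negbFE ->.
elim: n => [|n IHn].
  rewrite [RHS]big_nil big_nat big1// => i /andP[_ ic].
  exact: dyadicP ic.
have lec : (dyadic k n < dyadic k n.+1)%N.
  by rewrite ltnNge -leEnat increasing_dyadic ltnn.
(* Past [dyadic k n], no index before [dyadic k n.+1] lies in N_k, so a single new term survives. *)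
rewrite big_nat_recr//= (@big_cat_nat _ _ _ (dyadic k n))//= ?IHn ?(ltnW lec)//.
congr (op _ _); rewrite big_ltn// big_nat big1 ?Monoid.mulm1//.
move=> i /andP[ni iS].
apply: (dyadicP n.+1) => // ik; apply/negbTE; rewrite -leqNgt.
have := increasing_dyadic k (dyadic_idx i) n; rewrite -{1}ik dyadicK !leEnat.
by rewrite leqNgt ni /= => /esym/negbT; rewrite -ltnNge.
Qed.

(** The partial sums of the subseries are those of the full series at the points [dyadic k n]. These
    points are cofinal, so the two nondecreasing sequences are bounded together. *)
Lemma cvg_series_dyadic (R : realType) (v : nat -> R) k :
  (forall i, 0 <= v i) -> (forall i, dyadic_exp i != k -> v i = 0) ->
  cvgn (series (v \o dyadic k)) <-> cvgn (series v).
Proof.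
move=> v0 vk.
have nd (u : nat -> R) : (forall i, 0 <= u i) -> nondecreasing_seq (series u).
  by move=> u0; apply: nondecreasing_series.
have sE n : series v (dyadic k n) = series (v \o dyadic k) n.
  exact: big_dyadic.
split=> cv; apply: nondecreasing_is_cvgn; try (by apply: nd => i; exact: v0).
  exists (limn (series (v \o dyadic k))) => _ [N _ <-].
  apply: le_trans (nd _ v0 _ _ (leq_dyadic k N)) _; rewrite sE.
  by apply: nondecreasing_cvgn_le => //; apply: nd => i; exact: v0.
exists (limn (series v)) => _ [n _ <-]; rewrite -sE.
exact: nondecreasing_cvgn_le (nd _ v0) cv _.
Qed.

(** Stated over a [zmodType] since scalars, vectors and functionals are all spread over N_k in this
    way. *)
Definition stretch (V : zmodType) (k : nat) (x : nat -> V) (n : nat) : V :=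
  if dyadic_exp n == k then x (dyadic_idx n) else 0.

Lemma stretch_dyadic (V : zmodType) k (x : nat -> V) j :
  stretch k x (dyadic k j) = x j.
Proof. by rewrite /stretch dyadic_exp_dyadic eqxx dyadic_idx_dyadic. Qed.

(** Inserting zeros preserves the rank of each nonzero entry: as many precede place [dyadic k j] in
    the copy as precede place j in x. This is what makes condition (i) applicable to [stretch]. *)
Lemma nonzero_coords_stretch (V : zmodType) k (x : nat -> V) :
  nonzero_coords (stretch k x) = nonzero_coords x.
Proof.
apply/funext => r; rewrite /nonzero_coords.
have cE j : (\sum_(0 <= i < dyadic k j) (stretch k x i != 0%R))%N
            = (\sum_(0 <= i < j) (x i != 0%R))%N.
  rewrite big_dyadic; last by move=> i ik; rewrite /stretch (negbTE ik) eqxx.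
  by apply: eq_bigr => i _; rewrite stretch_dyadic.
congr (xget 0 _); apply/seteqP; split=> _ [n [nz nr] <-].
  have nk : dyadic_exp n = k.
    by apply/eqP; apply: contraNT nz => nk; rewrite /stretch (negbTE nk).
  rewrite -(dyadicK n) nk in nz nr *.
  rewrite stretch_dyadic in nz *.
  by exists (dyadic_idx n) => //; split=> //; exact: etrans (esym (cE _)) nr.
by exists (dyadic k n); rewrite /= stretch_dyadic//; split=> //;
  exact: etrans (cE n) nr.
Qed.

Lemma cvg_series_single (R : realType) (u : nat -> R) n :
  (forall i, i != n -> u i = 0) -> series u @ \oo --> u n.
Proof.
move=> u0; apply: cvg_near_cst; exists n.+1 => // N /= nN.
rewrite /series/= (bigD1_seq n) ?iota_uniq ?mem_index_iota//=.
by rewrite big1 ?addr0// => i; exact: u0.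
Qed.

(** * Positive functionals and their modulus in the dual *)

Section Dual.
Variables (R : realType) (E : banachLatticeType R).
Implicit Types f : E -> R.

Lemma dual_0 : dual (0 : E -> R).
Proof.
by split; [move=> a x y; rewrite mulr0 addr0 | exact: cst_continuous].
Qed.

Lemma scalar_dual f : scalar f -> (forall x, `|f x| <= `|x|) -> dual f.
Proof.
move=> fL fle; split=> // x; apply/cvgrPdist_lt => e e0.
near=> y; rewrite -scalarfB//; apply: le_lt_trans (fle _) _.
by near: y; apply: cvgr_dist_lt => //; exact: cvg_id.
Unshelve. all: by end_near. Qed.

(** A positive f is itself a least upper bound of f and -f. Two such bounds agree on the positive
    cone, hence everywhere because x = x^+ - x^-, so [xget] can only pick f. *)
Lemma dual_modulus_pos f : dual f -> dual_le (cst 0) f -> dual_modulus f = f.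
Proof.
move=> fd f0; rewrite /dual_modulus; apply: xget_subset1.
  split=> // x x0; apply: le_trans (f0 x x0).
  by rewrite oppr_le0; exact: f0.
move=> g h [gd fg nfg gmin] [hd fh nfh hmin].
have pos x : rle 0 x -> g x = h x.
  by move=> x0; apply/le_anti; rewrite gmin// hmin.
apply/funext => x; rewrite -(pos_partB x) (scalarfB gd.1) (scalarfB hd.1).
by rewrite !pos//; exact: pos_part_ge0.
Qed.

Lemma le_norm_pos_functional f x y : scalar f -> dual_le (cst 0) f ->
  rle x y -> f x <= f y.
Proof.
by move=> fL f0 /rsubr_ge0/f0 /=; rewrite scalarfB// subr_ge0.
Qed.

End Dual.

(** * Coordinate estimates and membership in the sequence spaces *)

Section SequenceLattice.
Variables (R : realType) (L : sequenceSpaceType R).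
Hypothesis hL : invariant_sequence_lattice L.

(** In the lattice, |a_n| e_n <= |a|, and e_n has norm 1. *)
Lemma le_coord_norm (a : L) n : `|Defs.coord a n| <= `|a|.
Proof.
have [e en e1] := inv_unit hL n.
have coordL i : scalar (fun b : L => Defs.coord b i) := coord_linear i.
have e0 : rle 0 e.
  by apply/le_coord => i; rewrite (scalarf0 (coordL i)) en ler0n.
suff : `| `|Defs.coord a n| *: e| <= `|modulus a|.
  by rewrite normrZ e1 mulr1 normr_id norm_modulus.
apply: ler_norm_pos; first exact: rscale_ge0.
apply/le_coord => i; rewrite (scalarfZ (coordL i)) en; case: eqP => [->|_];
  last first.
  rewrite mulr0 -(scalarf0 (coordL i)).
  by move/le_coord: (modulus_ge0 a).
rewrite mulr1 ler_norml lerNl -(scalarfN (coordL n)).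
by move/le_coord: (rle_modulus a) => ->; move/le_coord: (rle_modulusN a) => ->.
Qed.

Lemma kothe_dual_single (b : nat -> R) n :
  (forall i, i != n -> b i = 0) -> kothe_dual L b.
Proof.
move=> b0 a; apply: cvgP; apply: (@cvg_series_single _ _ n) => i /= /b0 ->.
by rewrite mulr0 normr0.
Qed.

Lemma kothe_norm_single (b : nat -> R) n :
  (forall i, i != n -> b i = 0) -> (kothe_norm L b <= `|b n|%:E)%E.
Proof.
move=> b0; apply: ge_ereal_sup => _ [a a1 <-]; rewrite lee_fin.
rewrite (cvg_lim _ (@cvg_series_single _ _ n _))//=; last first.
  by move=> i /= /b0 ->; rewrite mulr0.
rewrite normrM ler_piMl//; exact: le_trans (le_coord_norm a n) a1.
Qed.

Lemma kothe_dual_stretch k (b : nat -> R) :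
  kothe_dual L b -> kothe_dual L (stretch k b).
Proof.
move=> Lb; apply/(inv_nonzero hL).
by rewrite nonzero_coords_stretch -inv_nonzero.
Qed.

Variable E : banachLatticeType R.
Implicit Types x y z : nat -> E.

(** Test the supremum on the sequence with a positive functional norming |z_n| in place n and 0
    elsewhere. Its eps-norm is at most 1 by [kothe_norm_single]. *)
Lemma le_norm_pi z n : (`|z n|%:E <= norm_pi L E z)%E.
Proof.
have [f [fL f0 fle fz]] := positive_norming_functional (modulus_ge0 (z n)).
have fd := scalar_dual fL fle.
pose F (i : nat) : E -> R := if i == n then f else 0.
have Fd i : dual (F i) by rewrite /F; case: ifP => // _; exact: dual_0.
have F0 i : dual_le (cst 0) (F i).
  by rewrite /F; case: ifP => // _ x _; exact: lexx.
have FmE i : dual_modulus (F i) = F i by exact: dual_modulus_pos.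
have FmN (x : E) i : i != n -> dual_modulus (F i) x = 0.
  by rewrite FmE /F => /negbTE ->.
rewrite -norm_modulus -fz; apply: ereal_sup_ubound; exists F; last first.
  congr (_%:E); rewrite (cvg_lim _ (@cvg_series_single _ _ n _))//=.
    by rewrite /F eqxx.
  by move=> i; rewrite /F => /negbTE ->.
split.
  split=> //; split=> // x _.
  by apply: (@kothe_dual_single _ n) => i; exact: FmN.
apply: ge_ereal_sup => _ [x [x0 x1] <-].
apply: le_trans (kothe_norm_single (FmN x)) _.
by rewrite FmE /F eqxx lee_fin; exact: le_trans (fle x) x1.
Qed.

(** Comparison test for each positive f. Allowing a combination of two dominating sequences settles
    linear and lattice operations alike. *)
Lemma lambda_pi_dominated (a : R) x y z :
  0 <= a -> lambda_pi L E x -> lambda_pi L E y ->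
  (forall n, rle (modulus (z n)) (a *: modulus (x n) + modulus (y n))) ->
  lambda_pi L E z.
Proof.
move=> a0 xp yp zxy f fp; have [[fd _] f0] := fp.
have := is_cvg_seriesD (is_cvg_seriesZ (k := a) (xp f fp)) (yp f fp).
apply: series_le_cvg => n /=; first exact/f0/modulus_ge0.
  by apply: addr_ge0; [apply: mulr_ge0 => //|]; exact/f0/modulus_ge0.
by apply: le_trans (le_norm_pos_functional (fd n).1 (f0 n) (zxy n)) _;
  rewrite (fd n).1.
Qed.

Lemma lambda_s_sub x y : lambda_s L E x -> lambda_s L E y ->
  lambda_s L E (fun n => x n - y n).
Proof.
move=> xs ys f fw; have := is_cvg_seriesD (xs f fw) (ys f fw).
apply: series_le_cvg => n /=; first exact: normr_ge0.
  exact: (addr_ge0 (normr_ge0 _) (normr_ge0 _)).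
by rewrite (scalarfB (fw.1 n).1); exact: ler_normB.
Qed.

(** Testing z against f spread over N_k ignores the entries of z outside N_k, and on N_k the terms
    are |a| |f_j(x_j)|; dividing by |a| gives convergence for x. *)
Lemma lambda_s_stretch k (a : R) x z : a != 0 ->
  lambda_s L E z -> (forall j, z (dyadic k j) = a *: x j) -> lambda_s L E x.
Proof.
move=> a0 zs zx f fw; pose F : nat -> E -> R := stretch k f.
have Fd i : dual (F i).
  by rewrite /F /stretch; case: ifP => _; [exact: fw.1 | exact: dual_0].
have FE i v : F i v = stretch k (f ^~ v) i by rewrite /F /stretch; case: ifP.
have Fw : lambda'_w L E F.
  split=> // v; have -> : F ^~ v = stretch k (f ^~ v) by exact/funext.
  exact/kothe_dual_stretch/fw.2.
pose u n : R := `|F n (z n)|.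
have : cvgn (series (u \o dyadic k)).
  apply/cvg_series_dyadic; last exact: (zs F Fw).
    by move=> n; exact: normr_ge0.
  by move=> n /negbTE nk; rewrite /u FE /stretch nk normr0.
have -> : u \o dyadic k = `|a| *: (fun j => `|f j (x j)|).
  apply/funext => j /=; rewrite /u FE stretch_dyadic zx (scalarfZ (fw.1 j).1).
  by rewrite normrM.
move=> /(is_cvg_seriesZ (k := `|a|^-1));
  rewrite scalerA mulVf ?normr_eq0// scale1r.
exact.
Qed.

(** Testing the copy against f amounts to testing x against the subsequence [f \o dyadic k], which
    condition (ii) keeps in the dual space. *)
Lemma lambda_pi_stretch k x : (forall n, rle 0 (x n)) ->
  lambda_pi L E x -> lambda_pi L E (stretch k x).
Proof.
move=> x0 xp f fp; have [[fd fk] f0] := fp.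
have m0 : modulus (0 : E) = 0 by apply/modulus_id/rle_refl.
apply/(@cvg_series_dyadic _ _ k).
- by move=> i; exact/f0/modulus_ge0.
- by move=> i /negbTE ik; rewrite /stretch ik m0 (scalarf0 (fd i).1).
have -> : (fun n => f n (modulus (stretch k x n))) \o dyadic k =
          fun j => (f \o dyadic k) j (modulus (x j)).
  by apply/funext => j /=; rewrite stretch_dyadic.
apply: xp; split; last by move=> j; exact: f0.
split; first by move=> j; exact: fd.
move=> v v0; exact: (inv_subseq hL (fk v v0) (increasing_dyadic k)).
Qed.

(** * The sublattice generated by the copies of a positive sequence *)

Lemma latticeable_of_pos x : (forall n, rle 0 (x n)) ->
  lambda_pi L E x -> ~ lambda_s L E x ->
  completely_latticeable (lambda_pi L E) (norm_pi L E)
    (lambda_pi L E `\` lambda_s L E).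
Proof.
move=> x0 xp xNs.
(* The zero sequence is in lambda_s(E), so x has a nonzero entry; the coefficients a_k will be read
   off at this entry. *)
have [j0 xj0] : exists j, x j != 0.
  apply: contra_notP xNs => /forallNP xz f fw; apply: cvgP.
  apply: (@cvg_series_single _ _ 0) => i _ /=.
  have /negP := xz i; rewrite negbK => /eqP ->.
  by rewrite (scalarf0 (fw.1 i).1) normr0.
have nx0 : 0 < `|x j0| by rewrite normr_gt0.
pose M := [set z | lambda_pi L E z /\
  exists a : nat -> R, forall k j, z (dyadic k j) = a k *: x j].
(* A bound on the coefficients gives a bound on the moduli because x is positive and the N_k cover
   N; every closure property of M reduces to this. *)
have Mdom (t : R) y y' z (a a' c : nat -> R) : 0 <= t ->
    lambda_pi L E y -> lambda_pi L E y' ->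
    (forall k j, y (dyadic k j) = a k *: x j) ->
    (forall k j, y' (dyadic k j) = a' k *: x j) ->
    (forall k j, z (dyadic k j) = c k *: x j) ->
    (forall k, `|c k| <= t * `|a k| + `|a' k|) -> M z.
  move=> t0 yp yp' ya ya' zc caa; split; last by exists c.
  apply: (lambda_pi_dominated t0 yp yp') => n.
  rewrite -(dyadicK n) ya ya' zc !modulus_scale// scalerA -scalerDl.
  exact: rle_scaler.
exists M; split.
- split.
  + by move=> z [].
  + split; last by exists (fun=> 0) => k j; rewrite scale0r.
    apply: (lambda_pi_dominated (lexx 0) xp xp) => n.
    by rewrite scale0r add0r modulus_id; [exact: modulus_ge0|exact: rle_refl].
  + move=> t y z [yp [a ya]] [zp [b zb]].
    apply: (Mdom `|t| y z _ a b (fun k => t * a k + b k)) => //.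
      by move=> k j; rewrite scalerDl -scalerA -ya -zb.
    by move=> k; rewrite -normrM; exact: ler_normD.
  + move=> y z [yp [a ya]] [zp [b zb]].
    apply: (Mdom 1 y z _ a b (fun k => Num.max (a k) (b k))) => //.
      by move=> k j; rewrite -rjoin_scale// -ya -zb.
    by move=> k; rewrite mul1r; case: (leP (a k) (b k)) => _;
      rewrite ?lerDl ?lerDr normr_ge0.
  + move=> y z [yp [a ya]] [zp [b zb]].
    apply: (Mdom 1 y z _ a b (fun k => Num.min (a k) (b k))) => //.
      by move=> k j; rewrite -rmeet_scale// -ya -zb.
    by move=> k; rewrite mul1r; case: (leP (a k) (b k)) => _;
      rewrite ?lerDl ?lerDr normr_ge0.
- move=> z zp zM; split=> //.
  have [f [fL f0 fle fx]] := positive_norming_functional (x0 j0).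
  (* For an element of M this quotient is exactly a_k, since f(x_j0) = ||x_j0||; it is therefore the
     only candidate for a limit. *)
  exists (fun k => f (z (dyadic k j0)) / `|x j0|) => k j.
  set c := _ / _; apply/eqP; rewrite -subr_eq0 -normr_le0;
    apply/ler_addgt0Pr => e e0.
  rewrite add0r.
  (* With y in M within e / C of z, the errors e / C and (e / C) ||x_j|| / ||x_j0|| add up to e. *)
  pose C := 1 + `|x j| / `|x j0|.
  have C0 : 0 < C by rewrite ltr_pwDl// divr_ge0.
  have [y [_ [a ya]] zy] := zM (e / C) (divr_gt0 e0 C0).
  have zyn n : `|z n - y n| <= e / C.
    by rewrite -lee_fin; apply: le_trans (ltW zy); exact: le_norm_pi (z - y) n.
  (* The left side is the absolute value of f at the difference of y and z in place
     [dyadic k j0]. *)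
  have ac : `|a k - c| * `|x j0| <= e / C.
    rewrite -[X in _ * X]normr_id -normrM mulrBl divfK ?gt_eqF// -fx.
    rewrite -scalarfZ// -scalarfB// -ya; apply: le_trans (fle _) _.
    by rewrite distrC; exact: zyn.
  have -> : z (dyadic k j) - c *: x j =
      (z (dyadic k j) - y (dyadic k j)) + (a k - c) *: x j.
    by rewrite ya scalerBl addrA subrK.
  apply: le_trans (ler_normD _ _) _; rewrite normrZ.
  have -> : e = e / C + e / C * (`|x j| / `|x j0|).
    by rewrite -[X in X + _]mulr1 -mulrDr divfK// gt_eqF.
  apply: lerD => //; rewrite mulrA ler_pdivlMr// mulrAC.
  exact: ler_wpM2r.
- move=> n; exists (fun i => stretch i x); split.
    move=> i; split; first exact: lambda_pi_stretch.
    exists (fun k => (k == val i)%:R) => k j;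
      rewrite /stretch dyadic_exp_dyadic dyadic_idx_dyadic.
    by case: eqP; rewrite ?scale1r ?scale0r.
  (* The copies have disjoint supports, so evaluation at [dyadic i j0] isolates c_i. *)
  move=> c c0 i; have := congr1 (fun z => z (dyadic i j0)) c0.
  rewrite fct_sumE (bigD1 i)//= big1 ?addr0.
    rewrite -[LHS]/(c i *: stretch i x (dyadic i j0)) stretch_dyadic => /eqP.
    by rewrite scaler_eq0 (negbTE xj0) orbF => /eqP.
  move=> l li; rewrite -[LHS]/(c l *: stretch l x (dyadic i j0)).
  have il : val i != val l by rewrite eq_sym.
  by rewrite /stretch dyadic_exp_dyadic (negbTE il) scaler0.
- move=> z [zp [a za]] z0; split=> // zs.
  have [k ak] : exists k, a k != 0.
    apply: contra_notP (negP z0) => /forallNP az; apply/eqP/funext => n.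
    rewrite -(dyadicK n) za; have /negP := az (dyadic_exp n).
    by rewrite negbK => /eqP ->; rewrite scale0r.
  by apply: xNs; exact: lambda_s_stretch ak zs (za k).
Qed.

End SequenceLattice.

(** * Reduction to a positive sequence *)

Theorem theorem3p7 (R : realType) (E : banachLatticeType R) (L : sequenceSpaceType R)
    (hL : invariant_sequence_lattice L) :
  lambda_pi L E `\` lambda_s L E = set0 \/
  completely_latticeable (lambda_pi L E) (norm_pi L E)
    (lambda_pi L E `\` lambda_s L E).
Proof.
have [->|/set0P[x [xp xNs]]] := eqVneq (lambda_pi L E `\` lambda_s L E) set0.
  by left.
right; pose xpos n := pos_part (x n); pose xneg n := pos_part (- x n).
have [/not_andP[pNs|nNs]|] :=
  pselect (~ (lambda_s L E xpos /\ lambda_s L E xneg)).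
- apply: (latticeable_of_pos hL _ _ pNs) => [n|]; first exact: pos_part_ge0.
  (* With coefficient 0 the bound is |x_n| alone, which dominates the positive part. *)
  apply: (lambda_pi_dominated (lexx 0) xp xp) => n.
  rewrite scale0r add0r modulus_id; first exact: pos_part_le_modulus.
  exact: pos_part_ge0.
- apply: (latticeable_of_pos hL _ _ nNs) => [n|]; first exact: pos_part_ge0.
  apply: (lambda_pi_dominated (lexx 0) xp xp) => n.
  rewrite scale0r add0r modulus_id; first exact: pos_partN_le_modulus.
  exact: pos_part_ge0.
move=> /contrapT[ps ns]; exfalso; apply: xNs.
have -> : x = fun n => xpos n - xneg n.
  by apply/funext => n; rewrite /xpos /xneg pos_partB.
exact: lambda_s_sub.
Qed.
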